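(* Let $n\ge 2$ and let $(L,[,\ldots,],\alpha)$ be a multiplicative $n$-ary Hom-Nambu algebra. Define the $(2n-1)$-ary product $$[x_1,\ldots,x_{2n-1}]^{(1)}=[[x_1,\ldots,x_n],\alpha(x_{n+1}),\ldots,\alpha(x_{2n-1})]$$ for $x_i\in L$. Then $L^1=(L,[,\ldots,]^{(1)},\alpha^2)$ (with all $2n-2$ twisting maps equal to $\alpha^2=\alpha\circ\alpha$) is a multiplicative $(2n-1)$-ary Hom-Nambu algebra.
   Context: We work over a fixed field $\mathbf{k}$ of characteristic $0$. For an integer $n\ge 2$, an $n$-ary Hom-algebra $(V,[,\ldots,],\alpha=(\alpha_1,\ldots,\alpha_{n-1}))$ consists of a $\mathbf{k}$-module $V$, an $n$-linear map $[,\ldots,]\colon V^{\otimes n}\to V$, and linear maps $\alpha_i\colon V\to V$ ($1\le i\le n-1$), called twisting maps. It is multiplicative if $\alpha_1=\cdots=\alpha_{n-1}=\alpha$ and $\alpha\circ[,\ldots,]=[,\ldots,]\circ\alpha^{\otimes n}$. When all twisting maps are equal, $\alpha$ denotes their common value. An $n$-ary Hom-Nambu algebra is an $n$-ary Hom-algebra satisfying the $n$-ary Hom-Nambu identity $$[\alpha_1(x_1),\ldots,\alpha_{n-1}(x_{n-1}),[y_1,\ldots,y_n]]=\sum_{i=1}^n[\alpha_1(y_1),\ldots,\alpha_{i-1}(y_{i-1}),[x_1,\ldots,x_{n-1},y_i],\alpha_i(y_{i+1}),\ldots,\alpha_{n-1}(y_n)]$$ for all $x_1,\ldots,x_{n-1},y_1,\ldots,y_n\in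 V$. *)

(* Defs.v *)
From HB Require Import structures.
From mathcomp Require Import all_boot all_order all_algebra.

Set Implicit Arguments.
Unset Strict Implicit.
Unset Printing Implicit Defensive.

Import GRing.Theory.
Local Open Scope ring_scope.

Section HomNambu.

Variables (K : fieldType) (V : lmodType K).

(* Slots are numbered from 0: the i-th argument (resp. twisting map) of the
   usual 1-based notation has index i - 1 in 'I_n (resp. 'I_n.-1). *)
Definition nary_op (n : nat) := {ffun 'I_n -> V} -> V.

Definition set_slot n (x : {ffun 'I_n -> V}) (i : 'I_n) (v : V) :
    {ffun 'I_n -> V} :=
  [ffun j => if j == i then v else x j].

Definition multilinear n (br : nary_op n) : Prop :=
  forall (x : {ffun 'I_n -> V}) (i : 'I_n), linear (fun v => br (set_slot x i v)).

(* (u_1, ..., u_{n-1}, z): [insub j] is [None] exactly at the last slot. *)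
Definition append_last n (u : 'I_n.-1 -> V) (z : V) : {ffun 'I_n -> V} :=
  [ffun j : 'I_n => if insub (val j) is Some k then u k else z].

(* (u_1, ..., u_{i-1}, z, u_i, ..., u_{n-1}), with z in slot i. *)
Definition insert_at n (i : 'I_n) (u : 'I_n.-1 -> V) (z : V) :
    {ffun 'I_n -> V} :=
  [ffun j => if unlift i j is Some k then u k else z].

Definition nary_hom_algebra n (br : nary_op n) (tw : 'I_n.-1 -> V -> V) : Prop :=
  multilinear br /\ forall i, linear (tw i).

Definition nary_multiplicative n (br : nary_op n) (tw : 'I_n.-1 -> V -> V) : Prop :=
  (forall i j, tw i =1 tw j) /\
  (forall i (x : {ffun 'I_n -> V}), tw i (br x) = br [ffun j => tw i (x j)]).

(* [lift i] enumerates the slots other than i in increasing order, so the k-th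
   twisting map is applied to the k-th of the y_j with j != i. *)
Definition hom_nambu_identity n (br : nary_op n) (tw : 'I_n.-1 -> V -> V) : Prop :=
  forall (x : {ffun 'I_n.-1 -> V}) (y : {ffun 'I_n -> V}),
    br (append_last (fun k => tw k (x k)) (br y)) =
    \sum_(i < n) br (insert_at i (fun k => tw k (y (lift i k)))
                                 (br (append_last x (y i)))).

Definition nary_hom_nambu n (br : nary_op n) (tw : 'I_n.-1 -> V -> V) : Prop :=
  nary_hom_algebra br tw /\ hom_nambu_identity br tw.

Lemma inner_slot_subproof n (i : 'I_n) : (i < 2 * n - 1)%N.
Proof.
case: n i => [[]//|n] i.
by rewrite mulSn mul1n addSn subn1 /= (leq_trans (ltn_ord i)) // leq_addl.
Qed.

Lemma outer_slot_subproof n (j : 'I_n) : (n + j - 1 < 2 * n - 1)%N.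
Proof.
case: n j => [[]//|n] j.
by rewrite mulSn mul1n !addSn !subn1 /= ltn_add2l ltn_ord.
Qed.

Definition inner_slot n (i : 'I_n) : 'I_(2 * n - 1) :=
  Ordinal (inner_slot_subproof i).

(* Slot j > 0 of the outer bracket receives the argument of (0-based) index
   n + j - 1; the value at j = 0 is never used. *)
Definition outer_slot n (j : 'I_n) : 'I_(2 * n - 1) :=
  Ordinal (outer_slot_subproof j).

Definition derived_bracket n (br : nary_op n) (alpha : V -> V) :
    nary_op (2 * n - 1) :=
  fun x => br [ffun j : 'I_n =>
    if val j == 0%N then br [ffun i : 'I_n => x (inner_slot i)]
    else alpha (x (outer_slot j))].

End HomNambu.

(* Main.v *)
Require Import Defs.
From mathcomp Require Import all_boot all_order all_algebra.
From mathcomp Require Import zify.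

Set Implicit Arguments.
Unset Strict Implicit.
Unset Printing Implicit Defensive.

Import GRing.Theory.
Local Open Scope ring_scope.

(** Write [ad_w z = [w_1, ..., w_(n-1), z]].  Grouping the arguments, the
    derived bracket satisfies [[x_1, ..., x_(2n-2), z]^(1) = ad_w (alpha z)] with
    [w = ([x_1, ..., x_n], alpha x_(n+1), ..., alpha x_(2n-2))].  Its Hom-Nambu
    identity then results from two applications of that of the original bracket:
    [ad_(alpha^2 w)] is first expanded on the outer bracket of
    [alpha [y_1, ..., y_(2n-1)]^(1)], which yields one summand for each outer
    argument, and [ad_(alpha w)] is then expanded on the inner bracket
    [[alpha y_1, ..., alpha y_n]], which yields one summand for each inner one. *)

Section Slots.

Context {K : fieldType} {V : lmodType K}.
Implicit Types (n : nat) (z : V).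

Definition map_slots n (f : V -> V) (x : {ffun 'I_n -> V}) : {ffun 'I_n -> V} :=
  [ffun j => f (x j)].

(** With one common twisting map the reindexing by [lift] disappears, so the summands of the
    Hom-Nambu identity take the form to which multilinearity applies. *)
Lemma insert_at_set_slot n (i : 'I_n) (f : V -> V) (y : {ffun 'I_n -> V}) z :
  insert_at i (fun k => f (y (lift i k))) z = set_slot (map_slots f y) i z.
Proof.
apply/ffunP => j; rewrite !ffunE eq_sym.
by case: unliftP => [k ->|->]; rewrite ?eqxx // (negPf (neq_lift _ _)).
Qed.

Lemma map_set_slot n (f : V -> V) (x : {ffun 'I_n -> V}) (i : 'I_n) z :
  map_slots f (set_slot x i z) = set_slot (map_slots f x) i (f z).
Proof. by apply/ffunP => j; rewrite !ffunE; case: eqP. Qed.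

Lemma map_append_last n (f : V -> V) (u : 'I_n.-1 -> V) z :
  map_slots f (append_last u z) = append_last (fun k => f (u k)) (f z).
Proof. by apply/ffunP => j; rewrite !ffunE; case: insubP. Qed.

Lemma eq_append_last n (u v : 'I_n.-1 -> V) z :
  u =1 v -> append_last u z = append_last v z.
Proof. by move=> uv; apply/ffunP => j; rewrite !ffunE; case: insubP. Qed.

Lemma append_last_init n (u : 'I_n.-1 -> V) z z' (k : 'I_n) :
  (k < n.-1)%N -> append_last u z k = append_last u z' k.
Proof. by move=> kn; rewrite !ffunE insubT. Qed.

Lemma append_last_final n (u : 'I_n.-1 -> V) z (k : 'I_n) :
  (n.-1 <= k)%N -> append_last u z k = z.
Proof. by move=> kn; rewrite ffunE insubF //= ltnNge kn. Qed.

Lemma multilinear_sum n (br : nary_op V n) (x : {ffun 'I_n -> V}) (i : 'I_n)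
    (I : finType) (F : I -> V) :
  multilinear br ->
  br (set_slot x i (\sum_k F k)) = \sum_k br (set_slot x i (F k)).
Proof.
move=> lin.
have addB u v : br (set_slot x i (u + v)) = br (set_slot x i u) + br (set_slot x i v).
  by have := lin x i 1 u v; rewrite !scale1r.
apply: (big_morph (fun v => br (set_slot x i v))) => //.
(* The empty sum requires the bracket to vanish at 0, which follows from additivity by
   cancellation. *)
by apply: (addrI (br (set_slot x i 0))); rewrite -addB !addr0.
Qed.

End Slots.

Section DerivedBracket.

Context {K : fieldType} {V : lmodType K} {m : nat}.
Local Notation n := m.+2.
Context (br : nary_op V n) (alpha : V -> V).
Implicit Types (x y : {ffun 'I_(2 * n - 1) -> V}) (z : V).

Definition inner_args x : {ffun 'I_n -> V} := [ffun i => x (inner_slot i)].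

(** Slot 0 is overwritten because [outer_slot ord0] has index n - 1, which is the last inner slot;
    hence the conditions [j != ord0] below. *)
Definition outer_args x : {ffun 'I_n -> V} :=
  set_slot [ffun j => alpha (x (outer_slot j))] ord0 (br (inner_args x)).

Lemma derived_bracketE x : derived_bracket br alpha x = br (outer_args x).
Proof. by congr br; apply/ffunP => j; rewrite !ffunE. Qed.

Lemma inner_slot_neq_outer (i j : 'I_n) :
  j != ord0 -> (outer_slot j == inner_slot i) = false.
Proof.
move=> j0; apply/negP => /eqP/(congr1 val) /=.
by move: j0 (ltn_ord i); rewrite -val_eqE /=; lia.
Qed.

Lemma eq_outer_slot (i j : 'I_n) : (outer_slot i == outer_slot j) = (i == j).
Proof. by rewrite -!val_eqE /= !addSn !subn1 /= -!addSn eqn_add2l. Qed.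

Lemma eq_inner_slot (i j : 'I_n) : (inner_slot i == inner_slot j) = (i == j).
Proof. by rewrite -!val_eqE. Qed.

(** Splitting the ordinal along this sum separates the n inner slots from the n - 1 outer ones. *)
Let card_slots : (n + m.+1 = 2 * n - 1)%N. Proof. lia. Qed.

Let cast_lshift (i : 'I_n) : cast_ord card_slots (lshift _ i) = inner_slot i.
Proof. exact/val_inj. Qed.

Let cast_rshift (j : 'I_m.+1) :
  cast_ord card_slots (rshift _ j) = outer_slot (lift ord0 j).
Proof. by apply/val_inj; rewrite /= /bump /=; lia. Qed.

Variant slot_spec : 'I_(2 * n - 1) -> Type :=
  | InnerSlot i : slot_spec (inner_slot i)
  | OuterSlot (j : 'I_n) of j != ord0 : slot_spec (outer_slot j).

Lemma slotP k : slot_spec k.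
Proof.
rewrite -(cast_ordKV card_slots k); case: (split_ordP (cast_ord (esym card_slots) k)) => j ->.
  by rewrite cast_lshift; constructor.
by rewrite cast_rshift; constructor.
Qed.

Lemma sum_slots (F : 'I_(2 * n - 1) -> V) :
  \sum_k F k =
  \sum_i F (inner_slot i) + \sum_(j < m.+1) F (outer_slot (lift ord0 j)).
Proof.
rewrite (reindex (cast_ord card_slots)) /=; last first.
  by apply: onW_bij; exists (cast_ord (esym card_slots)) => k; apply/val_inj.
by rewrite big_split_ord; congr (_ + _); apply: eq_bigr => j _;
   rewrite ?cast_lshift ?cast_rshift.
Qed.

Lemma derived_set_inner x i z :
  derived_bracket br alpha (set_slot x (inner_slot i) z) =
  br (set_slot (outer_args x) ord0 (br (set_slot (inner_args x) i z))).
Proof.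
rewrite derived_bracketE; congr br; apply/ffunP => j; rewrite !ffunE.
case: (eqVneq j ord0) => [_|j0]; last by rewrite inner_slot_neq_outer.
by congr br; apply/ffunP => k; rewrite !ffunE eq_inner_slot.
Qed.

Lemma derived_set_outer x (j : 'I_n) z : j != ord0 ->
  derived_bracket br alpha (set_slot x (outer_slot j) z) =
  br (set_slot (outer_args x) j (alpha z)).
Proof.
move=> j0; rewrite derived_bracketE; congr br; apply/ffunP => k; rewrite !ffunE.
case: (eqVneq k ord0) => [->|k0].
  rewrite eq_sym (negPf j0); congr br; apply/ffunP => i.
  by rewrite !ffunE eq_sym inner_slot_neq_outer.
by rewrite eq_outer_slot; case: ifP.
Qed.

Lemma derived_multilinear :
  linear alpha -> multilinear br -> multilinear (derived_bracket br alpha).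
Proof.
move=> lin_a lin_br x k a u v; case: (slotP k) => [i|j j0].
  by rewrite !derived_set_inner (lin_br (inner_args x)) lin_br.
by rewrite !derived_set_outer // lin_a lin_br.
Qed.

(** The map [f] is kept general so as to cover both [alpha] and its square. *)
Lemma outer_args_map (f : V -> V) x :
  (forall u, f (br u) = br (map_slots f u)) ->
  (forall z, f (alpha z) = alpha (f z)) ->
  outer_args (map_slots f x) = map_slots f (outer_args x).
Proof.
move=> fbr fa; rewrite /outer_args map_set_slot fbr.
have -> : inner_args (map_slots f x) = map_slots f (inner_args x).
  by apply/ffunP => i; rewrite !ffunE.
by congr set_slot; apply/ffunP => j; rewrite !ffunE fa.
Qed.

Lemma derived_map (f : V -> V) x :
  (forall u, f (br u) = br (map_slots f u)) ->
  (forall z, f (alpha z) = alpha (f z)) ->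
  f (derived_bracket br alpha x) = derived_bracket br alpha (map_slots f x).
Proof. by move=> fbr fa; rewrite !derived_bracketE fbr outer_args_map. Qed.

(* The last entry of [append_last x 0] does not affect the first n - 1 outer
   arguments; 0 is a dummy, chosen because it is fixed by linear maps. *)
Definition ad_args (x : 'I_(2 * n - 1).-1 -> V) (k : 'I_m.+1) : V :=
  outer_args (append_last x 0) (widen_ord (leqnSn _) k).

(** As n >= 2, the last argument (index 2n - 2) lies beyond the inner bracket and fills only the
    last outer slot, where it is twisted once. *)
Lemma outer_args_append (x : 'I_(2 * n - 1).-1 -> V) z :
  outer_args (append_last x z) = append_last (n := n) (ad_args x) (alpha z).
Proof.
apply/ffunP => j; case: (ltnP j m.+1) => [jm|mj].
  transitivity (ad_args x (Ordinal jm)); last first.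
    by rewrite ffunE (insubT (fun k => k < m.+1)%N jm).
  have -> : ad_args x (Ordinal jm) = outer_args (append_last x 0) j.
    by congr (outer_args _ _); apply/val_inj.
  rewrite [LHS]ffunE [RHS]ffunE; case: eqP => [_|/eqP j0].
    congr br; apply/ffunP => i; rewrite [LHS]ffunE [RHS]ffunE.
    by apply: append_last_init => /=; have := ltn_ord i; lia.
  rewrite [LHS]ffunE [RHS]ffunE; congr alpha; apply: append_last_init.
  by rewrite -val_eqE /= in j0 *; lia.
rewrite [RHS]append_last_final // [LHS]ffunE; case: eqP => [j0|_].
  by rewrite j0 in mj.
by rewrite [LHS]ffunE append_last_final //=; lia.
Qed.

Lemma ad_args_map (f : V -> V) (x : 'I_(2 * n - 1).-1 -> V) :
  (forall u, f (br u) = br (map_slots f u)) ->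
  (forall z, f (alpha z) = alpha (f z)) -> f 0 = 0 ->
  ad_args (fun k => f (x k)) =1 (fun k => f (ad_args x k)).
Proof.
move=> fbr fa f0 k.
by rewrite /ad_args -{1}f0 -map_append_last outer_args_map // ffunE.
Qed.

Lemma derived_hom_nambu_identity :
  linear alpha -> multilinear br ->
  (forall u, alpha (br u) = br (map_slots alpha u)) ->
  hom_nambu_identity br (fun _ => alpha) ->
  hom_nambu_identity (derived_bracket br alpha) (fun _ => alpha \o alpha).
Proof.
move=> lin_a lin_br abr nambu x y.
have a0 : alpha 0 = 0.
  have := lin_a 1 0 0; rewrite !scale1r addr0 => a00.
  by apply: (addrI (alpha 0)); rewrite -a00 addr0.
pose alpha2 := alpha \o alpha.
have a2br u : alpha2 (br u) = br (map_slots alpha2 u).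
  by rewrite /alpha2 /= !abr; congr br; apply/ffunP => j; rewrite !ffunE.
have map_map k (u : {ffun 'I_k -> V}) :
    map_slots alpha (map_slots alpha u) = map_slots alpha2 u.
  by apply/ffunP => j; rewrite !ffunE.
set w : {ffun 'I_n.-1 -> V} := [ffun k => ad_args x k].
have adE z : derived_bracket br alpha (append_last x z) =
             br (append_last w (alpha z)).
  rewrite derived_bracketE outer_args_append; congr br.
  by apply: eq_append_last => k; rewrite ffunE.
set aw : {ffun 'I_n.-1 -> V} := [ffun k => alpha (w k)].
set Y := outer_args (map_slots alpha y).
have alphaY : map_slots alpha Y = outer_args (map_slots alpha2 y).
  by rewrite -map_map [RHS]outer_args_map.
have aad z : br (append_last aw (alpha z)) = alpha (br (append_last w z)).
  rewrite abr map_append_last; congr br.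
  by apply: eq_append_last => k; rewrite ffunE.
(* By multiplicativity the first n - 1 outer arguments become [alpha] squared of [w], written as
   [alpha] of [aw] to fit the twist of the original identity. *)
have -> : derived_bracket br alpha
    (append_last (fun k => alpha2 (x k)) (derived_bracket br alpha y)) =
    br (append_last (fun k => alpha (aw k)) (br Y)).
  rewrite derived_bracketE outer_args_append derived_map // derived_bracketE.
  congr br; apply: eq_append_last => k.
  by rewrite ad_args_map /alpha2 //= ?a0 // !ffunE.
(* The summand of outer slot 0 must produce all n inner summands of the derived identity; the others
   match one to one. *)
rewrite nambu sum_slots big_ord_recl; congr (_ + _).
  rewrite insert_at_set_slot alphaY.
  have -> : Y ord0 = br (map_slots alpha (inner_args y)).
    by rewrite ffunE eqxx; congr br; apply/ffunP => i; rewrite !ffunE.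
  (* Exposing [aw] as twisted arguments allows the second use of the identity; linearity in slot 0
     then moves its sum outside. *)
  rewrite (@eq_append_last _ _ n aw (fun k => alpha (w k))) => [|k]; last first.
    by rewrite ffunE.
  rewrite nambu multilinear_sum //; apply: eq_bigr => i _.
  rewrite insert_at_set_slot (insert_at_set_slot _ alpha2) derived_set_inner.
  rewrite map_map adE !ffunE; congr (br (set_slot _ _ (br (set_slot _ _ _)))).
  by apply/ffunP => k; rewrite !ffunE.
apply: eq_bigr => j _.
rewrite insert_at_set_slot (insert_at_set_slot _ alpha2) derived_set_outer //.
(* An outer argument carries its own [alpha], which [aad] moves past the action of [w]. *)
by rewrite alphaY adE -aad !ffunE.
Qed.

End DerivedBracket.

Theorem theorem5p1 (K : fieldType) (charK0 : [pchar K] =i pred0)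
    (n : nat) (hn : (2 <= n)%N) (L : lmodType K)
    (br : nary_op L n) (alpha : L -> L)
    (hL : nary_hom_nambu br (fun _ => alpha))
    (hmult : nary_multiplicative br (fun _ => alpha)) :
  nary_hom_nambu (derived_bracket br alpha) (fun _ => alpha \o alpha) /\
  nary_multiplicative (derived_bracket br alpha) (fun _ => alpha \o alpha).
Proof.
case: n hn br hL hmult => [|[|m]] // _ {}br [[lin_br lin_a] nambu] [_ mult].
(* Index 0 exists among the n - 1 twisting maps because n >= 2. *)
have {}lin_a := lin_a ord0; have {}mult := mult ord0.
split; last first.
  split=> // _ x /=; rewrite !derived_map //.
  by congr derived_bracket; apply/ffunP => j; rewrite !ffunE.
split; last exact: derived_hom_nambu_identity.
split; first exact: derived_multilinear.
by move=> _ a u v /=; rewrite !lin_a.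
Qed.
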